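(* Let $k\ge 2$ be an even integer, and let $S_k$ (a set of $2k+1$ points) and $\mathcal D$ (a set of $k$ directions) be as defined in the context. Then the unique minimum-length $\mathcal D$-monotone geometric spanning tree of $S_k$ is the star $T^\star$ with center $o$ and edges $ov_0,\dots,ov_{2k-1}$; in particular its maximum degree is $\deg_{T^\star}(o)=2k$.
   Context: Let $k\ge 2$ be even. Let $\mathcal D=\{d_1,\dots,d_k\}$ where $d_i=(\cos((i-1)\pi/k),\sin((i-1)\pi/k))$, so consecutive directions differ by angle $\pi/k$. The lines through the origin $o$ orthogonal to the $d_i$ partition the plane into $2k$ wedges $W_0,\dots,W_{2k-1}$, where (since $k$ is even) $W_i$ is the wedge of polar angles in $[i\pi/k,(i+1)\pi/k]$. Let $S_k=\{o\}\cup\{v_0,\dots,v_{2k-1}\}$, where $v_i$ is the point on the unit circle at polar angle $i\pi/k+\frac{2\pi}{3k}$ (the second angle-trisector of $W_i$ in counterclockwise order); thus $v_0,\dots,v_{2k-1}$ form a regular $2k$-gon centered at $o$, and these are called polygon vertices. A geometric path $\langle p_1,\dots,p_r\rangle$ is $d$-monotone if no two of its vertices lie on a common line orthogonal to $d$ and $\langle p_1,d\rangle,\dots,\langle p_r,d\rangle$ is strictly increasing or strictly decreasing. A geometric spanning tree of $S$ is a tree with vertex set $S$ whose edges are straight segments; its length is the sum of Euclidean edge lengths; it is $\mathcal D$-monotone if for every pair of vertices $u,v$ there is $d\in\mathcal D$ with the tree path from $u$ to $v$ $d$-monotone. *)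

(* Defs.v *)
From Stdlib Require Import Reals.
From mathcomp Require Import all_boot.
Set Implicit Arguments. Unset Strict Implicit. Unset Printing Implicit Defensive.

Local Open Scope R_scope.

Definition pt := (R * R)%type.
Definition dot (p q : pt) : R := p.1 * q.1 + p.2 * q.2.
Definition dist (p q : pt) : R := sqrt ((p.1 - q.1)^2 + (p.2 - q.2)^2).

(* The direction set D = {d_1,...,d_k}; index i : 'I_k stands for d_(i+1),
   i.e. the direction at polar angle i*pi/k. *)
Definition dir (k : nat) (i : 'I_k) : pt :=
  (cos (INR i * PI / INR k), sin (INR i * PI / INR k)).

(* Vertices of S_k: None = the origin o, Some i = polygon vertex v_i. *)
Definition vtx (k : nat) := option 'I_(k.*2).

Definition point (k : nat) (x : vtx k) : pt :=
  match x with
  | None => (0, 0)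
  | Some i => (cos (INR i * PI / INR k + 2 * PI / (3 * INR k)),
               sin (INR i * PI / INR k + 2 * PI / (3 * INR k)))
  end.

Definition simple_graph (V : finType) (E : {set V * V}) : Prop :=
  (forall x y, ((x, y) \in E) = ((y, x) \in E)) /\ (forall x, (x, x) \notin E).

Definition adj (V : finType) (E : {set V * V}) : rel V := fun x y => (x, y) \in E.

Definition is_path (V : finType) (E : {set V * V}) (u v : V) (s : seq V) : Prop :=
  path (adj E) u s /\ last u s = v /\ uniq (u :: s).

Definition is_tree (V : finType) (E : {set V * V}) : Prop :=
  simple_graph E /\
  forall u v : V, (exists s, is_path E u v s) /\
    (forall s1 s2, is_path E u v s1 -> is_path E u v s2 -> s1 = s2).

Fixpoint strictly_incr (l : list R) : Prop :=
  match l with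
  | x :: ((y :: _) as t) => x < y /\ strictly_incr t
  | _ => True
  end.

Fixpoint strictly_decr (l : list R) : Prop :=
  match l with
  | x :: ((y :: _) as t) => y < x /\ strictly_decr t
  | _ => True
  end.

(* A geometric path with vertex points ps is d-monotone. (Strict monotonicity
   of the projections implies that no two vertices lie on a common line
   orthogonal to d.) *)
Definition d_monotone (d : pt) (ps : seq pt) : Prop :=
  (forall i j, (i < size ps)%nat -> (j < size ps)%nat -> i <> j ->
     dot (nth (0,0) ps i) d <> dot (nth (0,0) ps j) d) /\
  (strictly_incr (map (fun p => dot p d) ps) \/
   strictly_decr (map (fun p => dot p d) ps)).

Definition D_monotone_spanning_tree (k : nat) (E : {set vtx k * vtx k}) : Prop :=
  is_tree E /\
  forall (u v : vtx k) (s : seq (vtx k)), is_path E u v s ->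
    exists i : 'I_k, d_monotone (dir i) (map (@point k) (u :: s)).

(* Euclidean length: each unordered edge counted once. *)
Definition tree_length (k : nat) (E : {set vtx k * vtx k}) : R :=
  / 2 * \big[Rplus/0]_(e in E) dist (point e.1) (point e.2).

Definition star (k : nat) : {set vtx k * vtx k} :=
  [set e | ((e.1 == None) && (e.2 != None)) || ((e.2 == None) && (e.1 != None))].

Definition degree (V : finType) (E : {set V * V}) (x : V) : nat :=
  #|[set y | (x, y) \in E]|.

(* Main.v *)
(* Root a monotone tree at [o].  A branch hanging from [v_c] cannot contain the
   antipode of [v_c], and if it contains more than [v_c], then the last vertices
   before its boundary force it to be exactly the half-circle
   [v_c, v_(c-1), ..., v_(c-k+1)], all reached from [v_c] monotonically in one
   fixed direction.  In every direction at most one polygon vertex projects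
   strictly between two consecutive ones, so consecutive vertices of a branch
   are adjacent or have a common neighbour, whose index parity is forced.  This
   leaves only the zigzag [v_c, v_(c-k+1), v_(c-1), v_(c-k+2), ...] (up to its
   last edge), whose [k - 1] inner edges have lengths [2 sin (t pi / 2k)] for
   [0 < t < k]; pairing [t] with [k - t], [sin + cos > 1] shows that they add up
   to more than [k - 1].  So any branch but a single spoke is longer than the
   spokes it replaces. *)
From HB Require Import structures.
From Stdlib Require Import Reals ZArith Lra Lia.
From mathcomp Require Import all_boot zify.
Require Import Defs.
Set Implicit Arguments.
Unset Strict Implicit.
Unset Printing Implicit Defensive.

Delimit Scope R_scope with R.
Delimit Scope Z_scope with Z.
Delimit Scope nat_scope with N.
Local Arguments Z.mul : simpl never.
Local Arguments Z.add : simpl never.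

(** * Rooted trees *)

Section RootedTree.
Context (V : finType) (E : {set V * V}) (o : V).
Hypothesis treeE : is_tree E.

Lemma edge_sym x y : ((x, y) \in E) = ((y, x) \in E).
Proof. by case: treeE => -[]. Qed.

Lemma edge_neq x y : (x, y) \in E -> x != y.
Proof. by case: treeE => -[_ irr] _ xy; apply: contraL xy => /eqP->. Qed.

Lemma is_path_uniq u v s1 s2 : is_path E u v s1 -> is_path E u v s2 -> s1 = s2.
Proof. by case: treeE => _ /(_ u v)[_]; apply. Qed.

(** The boolean form allows [xchoose] to turn root paths into a function. *)
Definition is_pathb u v s := [&& path (adj E) u s, last u s == v & uniq (u :: s)].

Lemma is_pathP u v s : reflect (is_path E u v s) (is_pathb u v s).
Proof.
by apply: (iffP and3P) => [[? /eqP ? ?]|[? [? ?]]]; do ?split=> //; apply/eqP.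
Qed.

Lemma ex_pathb v : exists s, is_pathb o v s.
Proof. by case: treeE => _ /(_ o v)[[s sP] _]; exists s; apply/is_pathP. Qed.

Definition root_path v := xchoose (ex_pathb v).

Lemma root_pathP v : is_path E o v (root_path v).
Proof. exact/is_pathP/xchooseP. Qed.

Lemma root_path_eq v s : is_path E o v s -> root_path v = s.
Proof. exact/is_path_uniq/root_pathP. Qed.

Lemma root_path_root : root_path o = [::].
Proof. by apply: root_path_eq; split. Qed.

(** The default [o] of [last] serves twice: it is the parent of a child of the root, and it makes
    the root its own parent. *)
Definition parent v := last o (rev (behead (rev (root_path v)))).
Definition branch v := head o (root_path v).

Lemma root_path_rcons v : v != o ->
  root_path v = rcons (root_path (parent v)) v.
Proof.
move=> vo; have [] := root_pathP v; rewrite /parent.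
case: (lastP (root_path v)) => [_ [/= ov]|s x]; first by rewrite ov eqxx in vo.
rewrite rcons_path last_rcons => /andP[ps ex] [<- us].
rewrite rev_rcons /= revK; congr rcons; apply/esym/root_path_eq.
by split=> //; split=> //; move: us; rewrite -rcons_cons rcons_uniq => /andP[].
Qed.

Lemma parent_edge v : v != o -> (parent v, v) \in E.
Proof.
move=> vo; have [] := root_pathP v; rewrite (root_path_rcons vo) rcons_path.
by case: (root_pathP (parent v)) => _ [-> _] /andP[].
Qed.

Lemma parent_root : parent o = o.
Proof. by rewrite /parent root_path_root. Qed.

(** If [v] is off the root path of [u], appending it gives the root path of [v]. Otherwise the part
    of that path from [v] to [u] must be the edge itself, by uniqueness of paths. *)
Lemma edge_parent u v : (u, v) \in E ->
  (v != o /\ parent v = u) \/ (u != o /\ parent u = v).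
Proof.
move=> uv; have [pu [lu uu]] := root_pathP u.
have [vin|vnin] := boolP (v \in o :: root_path u); last first.
  left; have vo : v != o by move: vnin; rewrite inE negb_or => /andP[].
  split=> //; rewrite /parent (@root_path_eq v (rcons (root_path u) v)).
    by rewrite rev_rcons /= revK lu.
  split; first by rewrite rcons_path pu lu.
  by rewrite last_rcons -rcons_cons rcons_uniq vnin uu.
right; case/splitPl def_p: {1}(root_path u) / vin => [p1 p2 lv].
have p2u : p2 = [:: u].
  apply: (@is_path_uniq v u).
    split; first by move: pu; rewrite def_p cat_path lv => /andP[].
    split; first by move: lu; rewrite def_p last_cat lv.
    move: uu; rewrite def_p -cat_cons cat_uniq => /and3P[_ /hasPn h u2] /=.
    rewrite u2 andbT; apply/negP => vp2; have := h _ vp2.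
    by rewrite -lv mem_last.
  split; first by rewrite /= /adj -edge_sym uv.
  by split=> //=; rewrite inE andbT eq_sym edge_neq.
split; last by rewrite /parent def_p p2u cats1 rev_rcons /= revK.
apply/eqP => uo; move: def_p; rewrite uo root_path_root p2u.
by case: p1 {lv}.
Qed.

Lemma branch_parent v : parent v != o -> branch v = branch (parent v).
Proof.
move=> po; have vo : v != o by apply: contraNneq po => ->; rewrite parent_root.
rewrite /branch (root_path_rcons vo).
by case: (root_path (parent v)) (root_path_rcons po) => // /esym/eqP; case: (root_path _).
Qed.

Lemma branch_child v : v != o -> parent v = o -> branch v = v.
Proof. by move=> vo po; rewrite /branch (root_path_rcons vo) po root_path_root. Qed.

Lemma root_path_branch v : v != o -> parent v != o ->
  exists s, root_path v = branch v :: rcons s v.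
Proof.
move=> vo po; rewrite branch_parent // (root_path_rcons vo) /branch.
case: (root_path (parent v)) (root_path_rcons po) => [|x s _].
  by move/esym/eqP; case: (root_path _).
by exists s.
Qed.

Lemma edge_branch u v : (u, v) \in E -> u != o -> v != o -> branch u = branch v.
Proof.
by move=> /edge_parent[][_ <-] uo vo; [rewrite [RHS]branch_parent|rewrite branch_parent].
Qed.

Lemma path_branch x s : x != o -> o \notin s -> path (adj E) x s ->
  all (fun y => branch y == branch x) s.
Proof.
elim: s x => //= y s IH x xo; rewrite inE negb_or eq_sym => /andP[yo os] /andP[xy ps].
have -> := edge_branch xy xo yo; rewrite eqxx /=; exact: IH.
Qed.

Lemma branch_root_path v x : x \in root_path v -> branch x = branch v.
Proof.
move=> xv; have [p [_ u]] := root_pathP v.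
rewrite /branch; case: (root_path v) xv p u => [//|y s xys /= /andP[oy ps]].
rewrite inE negb_or eq_sym => /andP[/andP[yo os] _].
have -> : y = branch y.
  have [[_ py]|[]] := edge_parent oy; last by rewrite eqxx.
  by rewrite branch_child.
have := path_branch yo os ps => /allP h.
by move: xys; rewrite inE => /orP[/eqP->//|/h/eqP].
Qed.

Lemma branch_neq v : v != o -> branch v != o.
Proof.
move=> vo; have [p [_]] := root_pathP v; rewrite /branch (root_path_rcons vo).
case: (root_path (parent v)) => [|x s] /=; first by [].
by rewrite inE negb_or eq_sym => /andP[/andP[]].
Qed.

Lemma parent_branch v : v != o -> parent (branch v) = o.
Proof.
move=> vo; have [+ _] := root_pathP v; have := branch_neq vo; rewrite /branch.
case: (root_path v) => [|x s] /= xo; first by rewrite eqxx in xo.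
by case/andP=> /edge_parent[[]//|[]]; rewrite eqxx.
Qed.

(** A root path stays in one branch once it has left [o], so root paths into different branches meet
    only in [o] and their concatenation is simple. *)
Lemma path_via_root u v : u != o -> v != o -> branch u != branch v ->
  exists s, rev (o :: root_path u) ++ root_path v = u :: s /\ is_path E u v s.
Proof.
move=> uo vo buv; have [pu [lu uu]] := root_pathP u.
have [pv [lv uv]] := root_pathP v.
exists (behead (rev (o :: root_path u)) ++ root_path v).
have eq_rev : rev (o :: root_path u) = u :: behead (rev (o :: root_path u)).
  by rewrite (root_path_rcons uo) -rcons_cons rev_rcons.
split; first by rewrite -cat_cons -eq_rev.
have last_rev : last u (behead (rev (o :: root_path u))) = o.
  by have := last_rcons u (rev (root_path u)) o; rewrite -rev_cons eq_rev.
split.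
  rewrite cat_path last_rev pv andbT.
  have := rev_path (adj E) o (root_path u).
  rewrite lu (@eq_path _ _ (adj E)) => [|x y]; last by rewrite /adj edge_sym.
  have -> : rev (belast o (root_path u)) = behead (rev (o :: root_path u)).
    by rewrite lastI rev_rcons.
  by move->.
split; first by rewrite last_cat last_rev.
rewrite -cat_cons -eq_rev cat_uniq rev_uniq uu.
move: uv => /= /andP[onv ->]; rewrite andbT.
apply/hasPn => x xv; rewrite mem_rev inE negb_or; apply/andP; split.
  by apply: contraNneq onv => <-.
apply: contra buv => xu.
by rewrite -(branch_root_path xu) -(branch_root_path xv).
Qed.

(** A path through [o] would split into the reversed root path of [u] and the root path of [v]; both
    contain the child of the root that names the common branch, so the path would not be simple. *)
Lemma path_same_branch u v s : is_path E u v s -> u != o -> v != o ->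
  branch u = branch v -> o \notin s.
Proof.
have branch_in x : x != o -> branch x \in root_path x.
  move=> xo; have := root_path_rcons xo; rewrite /branch.
  case: (root_path x) => [/esym/eqP|y t _]; last exact: mem_head.
  by case: (root_path _).
move=> [p [l us]] uo vo buv; apply/negP => os.
case/splitPr: os p l us => p1 p2; rewrite cat_path last_cat.
move=> /and3P[pp1 eo pp2] /= l2; rewrite -/(uniq (u :: p1 ++ o :: p2)).
rewrite -cat_cons cat_uniq => /and3P[u1 /hasPn d u2].
have rv : root_path v = p2 by apply: root_path_eq; split.
have ru : root_path u = rev (u :: p1).
  apply: root_path_eq; split.
    have := rev_path (adj E) u (rcons p1 o); rewrite last_rcons belast_rcons.
    rewrite (@eq_path _ _ (adj E)) => [->|x y]; last by rewrite /adj edge_sym.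
    by rewrite rcons_path pp1.
  split; first by rewrite rev_cons last_rcons.
  by rewrite /= mem_rev rev_uniq u1 andbT; apply: d; rewrite mem_head.
have := d (branch v); rewrite inE -{1}rv branch_in // orbT => /(_ isT)/negP; apply.
by have := branch_in u uo; rewrite ru mem_rev buv.
Qed.

End RootedTree.

HB.instance Definition _ := Monoid.isComLaw.Build R 0%R Rplus
 (fun x y z => esym (Rplus_assoc x y z)) Rplus_comm Rplus_0_l.

(** The ordered pairs in [E] are the pairs (parent, child) and their reversals, each family being in
    bijection with the vertices other than [o]. *)
Lemma sum_edges (V : finType) (E : {set V * V}) (o : V) (treeE : is_tree E)
    (F : V -> V -> R) (symF : forall x y, F x y = F y x) :
  \big[Rplus/0%R]_(e in E) F e.1 e.2 =
  (2 * \big[Rplus/0%R]_(v in [set~ o]) F v (parent o treeE v))%R.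
Proof.
pose p := parent o treeE.
pose down := [set (p v, v) | v in [set~ o]].
pose up := [set (v, p v) | v in [set~ o]].
have defE : E = down :|: up.
  apply/setP => -[u v]; apply/idP/setUP => [/(edge_parent o treeE)|].
    by case=> -[wo pw]; [left; apply/imsetP; exists v|right; apply/imsetP; exists u];
      rewrite ?inE // /p pw.
  by case=> /imsetP[w]; rewrite !inE => wo [-> ->];
    rewrite ?(edge_sym treeE w); apply: parent_edge.
have disj : [disjoint down & up].
  apply/pred0P => -[u v] /=; apply/negP => /andP[/imsetP[x + [-> vx]]].
  rewrite -{}vx !inE => vo /imsetP[w + [uw vw]]; rewrite -uw !inE => uo; rewrite -uw in vw.
  (* A pair oriented both ways makes [v] and [p v] parents of each other, yet a root path is one
     longer than that of its parent. *)
  have ppv : parent o treeE (p v) = v by rewrite [RHS]vw.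
  have /(congr1 size) := root_path_rcons treeE vo.
  by rewrite -/(p v) (root_path_rcons treeE uo) ppv !size_rcons; lia.
transitivity (\big[Rplus/0%R]_(e in [predU down & up]) F e.1 e.2).
  by apply: eq_bigl => e; rewrite {1}defE in_setU.
rewrite bigU //= /down /up !big_imset //=; try by move=> x y _ _ [].
rewrite (eq_bigr (fun v => F v (p v))) //.
by rewrite -RIneq.double.
Qed.

(** * Projections of the polygon *)

Lemma cos_sin_period_Z (x : R) (n : Z) :
  cos (x + 2 * IZR n * PI)%R = cos x /\ sin (x + 2 * IZR n * PI)%R = sin x.
Proof.
case: n => [|p|p]; first by rewrite Rmult_0_r Rmult_0_l Rplus_0_r.
  by rewrite -(positive_nat_Z p) -INR_IZR_INZ cos_period sin_period.
rewrite -(cos_period (x + 2 * IZR (Z.neg p) * PI) (Pos.to_nat p)).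
rewrite -(sin_period (x + 2 * IZR (Z.neg p) * PI) (Pos.to_nat p)).
have -> : (x + 2 * IZR (Z.neg p) * PI + 2 * INR (Pos.to_nat p) * PI = x)%R => //.
rewrite INR_IZR_INZ positive_nat_Z -[Z.neg p]/(- Z.pos p)%Z opp_IZR; ring.
Qed.

Lemma strictly_incr_cons x l : strictly_incr (x :: l) -> strictly_incr l.
Proof. by case: l => //= y l []. Qed.

Lemma strictly_incr_lt x0 l i j :
  strictly_incr l -> (i < j < size l)%N -> (nth x0 l i < nth x0 l j)%R.
Proof.
elim: l i j => [|x l IH] i j incr; first by rewrite ltn0 andbF.
case: j => [|j]; first by rewrite ltn0.
have incr_l := strictly_incr_cons incr.
case: i => [|i] /=; last exact: IH.
rewrite ltnS => jl; have x_lt : (x < nth x0 l 0)%R.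
  by case: l incr jl {IH incr_l} => // y l [].
case: j jl => // j jl; apply: (Rlt_trans _ _ _ x_lt); exact: IH.
Qed.

Lemma strictly_decr_opp l : strictly_decr l -> strictly_incr (map Ropp l).
Proof.
by elim: l => // x [|y l] IH //= [yx /IH]; split=> //; apply: Ropp_lt_contravar.
Qed.

Lemma strictly_incr_opp l : strictly_incr l -> strictly_decr (map Ropp l).
Proof.
by elim: l => // x [|y l] IH //= [yx /IH]; split=> //; apply: Ropp_lt_contravar.
Qed.

Section Fan.
Context (k : nat) (k_gt1 : (1 < k)%N) (k_even : ~~ odd k).

Let K := Z.of_nat k.
Let H := Z.of_nat k./2.

Lemma K_double : (K = 2 * H /\ 1 <= H)%Z.
Proof. by rewrite /K /H; lia. Qed.

Lemma INR_k_gt0 : (0 < INR k)%R.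
Proof. by apply: lt_0_INR; lia. Qed.

Lemma IZR_K : IZR K = INR k.
Proof. by rewrite INR_IZR_INZ. Qed.

Lemma vert_subproof (z : Z) : (Z.to_nat (z mod (2 * K)) < k.*2)%N.
Proof.
have [KH H1] := K_double.
by have := Z.mod_pos_bound z (2 * K) ltac:(lia); rewrite /K; lia.
Qed.

(** Indices range over all integers, read modulo [2 * K], so that rotations are plain additions and
    [lia] can treat them. *)
Definition vert (z : Z) : vtx k := Some (Ordinal (vert_subproof z)).

Lemma vert_ord (j : 'I_(k.*2)) : vert (Z.of_nat j) = Some j.
Proof.
congr Some; apply: val_inj => /=; rewrite Z.mod_small ?Nat2Z.id //.
by have := ltn_ord j; rewrite /K; lia.
Qed.

Lemma vert_shift (z n : Z) : vert (z + n * (2 * K)) = vert z.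
Proof.
have [KH H1] := K_double.
by congr Some; apply: val_inj => /=; rewrite Z.mod_add //; lia.
Qed.

Lemma vert_eq (y z : Z) : vert y = vert z -> exists n, (y = z + n * (2 * K))%Z.
Proof.
have [KH H1] := K_double.
case=> eq_mod; exists (y / (2 * K) - z / (2 * K))%Z.
have := Z.div_mod y (2 * K) ltac:(lia); have := Z.div_mod z (2 * K) ltac:(lia).
have := Z.mod_pos_bound z (2 * K) ltac:(lia).
have := Z.mod_pos_bound y (2 * K) ltac:(lia).
by nia.
Qed.

(** The start [B] of the window is free: each use places it so that index differences fall into the
    range that its integer arithmetic needs. *)
Lemma vertP (B : Z) (v : vtx k) : v != None ->
  exists z, (B <= z < B + 2 * K)%Z /\ v = vert z.
Proof.
have [KH H1] := K_double.
case: v => // j _; rewrite -vert_ord.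
exists (B + (Z.of_nat j - B) mod (2 * K))%Z.
have := Z.mod_pos_bound (Z.of_nat j - B) (2 * K) ltac:(lia).
split; first by lia.
rewrite -(vert_shift (B + _) ((Z.of_nat j - B) / (2 * K))); congr vert.
have := Z.div_mod (Z.of_nat j - B) (2 * K) ltac:(lia); lia.
Qed.

Lemma vert_inj (y z : Z) : (- (2 * K) < y - z < 2 * K)%Z -> vert y = vert z -> y = z.
Proof.
have [KH H1] := K_double => yz /vert_eq[n yE].
by case: (Z.lt_trichotomy n 0) => [h|[h|h]]; nia.
Qed.

Lemma vert_neq z : vert z != None.
Proof. by []. Qed.

Definition angle (z : Z) : R := (IZR (3 * z + 2) * PI / (3 * INR k))%R.

Lemma point_vert (z : Z) : point (vert z) = (cos (angle z), sin (angle z)).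
Proof.
have [KH H1] := K_double; have k0 := INR_k_gt0.
rewrite /point /vert /= INR_IZR_INZ Z2Nat.id; last first.
  by have := Z.mod_pos_bound z (2 * K) ltac:(lia); lia.
set r := (z mod _)%Z.
have -> : (IZR r * PI / INR k + 2 * PI / (3 * INR k) =
    angle z + 2 * IZR (- (z / (2 * K))) * PI)%R.
  have {1}-> : r = (z - 2 * K * (z / (2 * K)))%Z.
    by have := Z.div_mod z (2 * K) ltac:(lia); rewrite /r; lia.
  rewrite /angle opp_IZR minus_IZR plus_IZR !mult_IZR IZR_K; field; lra.
by have [-> ->] := cos_sin_period_Z (angle z) (- (z / (2 * K))).
Qed.

#[global] Opaque vert.

Definition dirZ (i : Z) : pt :=
  (cos (IZR i * PI / INR k), sin (IZR i * PI / INR k)).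

Definition proj (i : Z) (v : vtx k) : R := dot (point v) (dirZ i).

(* With [m = z - i] normalized to [-k <= m < k], [v_z] projects on [d_i] to
   [cosq |3m + 2|], and [o] to [cosq (3k/2)]: comparing projections amounts to
   comparing integers. *)
Definition cosq (q : Z) : R := cos (IZR q * PI / (3 * INR k)).

Lemma cosq_opp q : cosq (- q) = cosq q.
Proof. by rewrite /cosq opp_IZR -cos_neg; congr cos; field; have := INR_k_gt0; lra. Qed.

Lemma cosq_shift q n : cosq (q + n * (6 * K)) = cosq q.
Proof.
rewrite /cosq plus_IZR !mult_IZR IZR_K.
have [<- _] := cos_sin_period_Z (IZR q * PI / (3 * INR k)) n.
by congr cos; field; have := INR_k_gt0; lra.
Qed.

Lemma cosq_abs q : cosq (Z.abs q) = cosq q.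
Proof. by case: (Z.abs_spec q) => -[_ ->]; rewrite ?cosq_opp. Qed.

Lemma cosq_decr p q : (0 <= p < q)%Z -> (q <= 3 * K)%Z -> (cosq q < cosq p)%R.
Proof.
move=> [/IZR_le p0 /IZR_lt pq] /IZR_le; rewrite mult_IZR IZR_K => qK.
have k0 := INR_k_gt0; have pi0 := PI_RGT_0.
have bound r : (0 <= r <= 3 * INR k -> 0 <= r * PI / (3 * INR k) <= PI)%R.
  move=> [r0 rk]; split; first by apply: Rle_mult_inv_pos; nra.
  rewrite [X in (_ <= X)%R](_ : PI = 3 * INR k * PI / (3 * INR k))%R; last by field; lra.
  by apply: Rmult_le_compat_r; [apply/Rlt_le/Rinv_0_lt_compat; lra|nra].
have [b1 b2] := bound (IZR p) ltac:(lra); have [b3 b4] := bound (IZR q) ltac:(lra).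
apply: cos_decreasing_1 => //.
by apply: Rmult_lt_compat_r; [apply: Rinv_0_lt_compat; lra|nra].
Qed.

Lemma cosq_lt p q :
  (cosq p < cosq q)%R -> (0 <= p)%Z -> (q <= 3 * K)%Z -> (q < p)%Z.
Proof.
move=> pq p0 qK; case: (Z.lt_trichotomy p q) => [h|[h|//]].
  by have := @cosq_decr p q ltac:(lia) ltac:(lia); lra.
by move: pq; rewrite h; lra.
Qed.

Lemma proj_vertE i z : proj i (vert z) = cosq (3 * (z - i) + 2).
Proof.
rewrite /proj point_vert /dot /= -cos_minus /angle /cosq; congr cos.
rewrite !plus_IZR !mult_IZR minus_IZR; field; have := INR_k_gt0; lra.
Qed.

(** The value is 0. Evenness of [k] makes the right angle an integer number [3 * H] of thirds of a
    wedge, so [o] is ranked on the same scale as the vertices. *)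
Lemma proj_root i : proj i None = cosq (3 * H).
Proof.
rewrite /proj /dot /= !Rmult_0_l Rplus_0_l /cosq mult_IZR.
rewrite -cos_PI2; congr cos; have [KH _] := K_double; have k0 := INR_k_gt0.
have -> : INR k = (2 * IZR H)%R by rewrite -IZR_K KH mult_IZR.
by field; move: k0; rewrite -IZR_K KH mult_IZR; lra.
Qed.

(** Normalizing by at most one turn puts the rank [|3m + 2|] between 0 and [3 * K], where [cosq] is
    decreasing; the turn is kept as a disjunction of linear equations for [lia]. *)
Lemma proj_vert i z : (- (3 * K) <= z - i < 3 * K)%Z ->
  exists m, (- K <= m < K)%Z /\
    (m = z - i \/ m = z - i + 2 * K \/ m = z - i - 2 * K)%Z /\
    proj i (vert z) = cosq (Z.abs (3 * m + 2)).
Proof.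
move=> zi.
have shift n : proj i (vert z) = cosq (Z.abs (3 * (z - i + n * (2 * K)) + 2)).
  rewrite cosq_abs proj_vertE -(cosq_shift _ n); congr cosq; lia.
have [lo|lo] := Z_lt_le_dec (z - i) (- K).
  exists (z - i + 2 * K)%Z; rewrite (shift 1%Z); split; first lia.
  by split; [lia|congr (cosq (Z.abs _)); lia].
have [hi|hi] := Z_lt_le_dec (z - i) K.
  exists (z - i)%Z; rewrite (shift 0%Z); split; first lia.
  by split; [lia|congr (cosq (Z.abs _)); lia].
exists (z - i - 2 * K)%Z; rewrite (shift (- 1)%Z); split; first lia.
by split; [lia|congr (cosq (Z.abs _)); lia].
Qed.

Lemma proj_window i z : proj i (vert z) = cosq (Z.abs (3 * (z - i) + 2)).
Proof. by rewrite cosq_abs proj_vertE. Qed.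

(** The range is lopsided because of the offset 2 in the rank: the extreme ranks on the positive
    side are [3H - 2] at [m = -H] and [3H - 1] at [m = H - 1]. *)
Lemma cosq_inner m : (- K <= m < K)%Z ->
  (cosq (3 * H) < cosq (Z.abs (3 * m + 2)))%R -> (- H <= m < H)%Z.
Proof. by have [KH H1] := K_double => mK /cosq_lt; lia. Qed.

Lemma cosq_outer m : (cosq (Z.abs (3 * m + 2)) < cosq (3 * H))%R ->
  (m < - H \/ H <= m)%Z.
Proof. by have [KH H1] := K_double => /cosq_lt; lia. Qed.

Lemma proj_opp i (v : vtx k) : proj (i + K) v = (- proj i v)%R.
Proof.
rewrite /proj /dot /dirZ.
have -> : (IZR (i + K) * PI / INR k = IZR i * PI / INR k + PI)%R.
  by rewrite plus_IZR IZR_K; field; have := INR_k_gt0; lra.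
by rewrite neg_cos neg_sin /=; ring.
Qed.

Lemma proj_shift i n (v : vtx k) : proj (i + n * (2 * K)) v = proj i v.
Proof.
have [KH H1] := K_double.
have [->|/(vertP 0)[z [_ ->]]] := eqVneq v None; first by rewrite !proj_root.
rewrite !proj_vertE -(cosq_shift (_ + _) n); congr cosq; lia.
Qed.

(** Decreasing along a direction is increasing along its opposite, [K] steps further. With all
    [2 * K] directions at hand only increasing paths remain to be studied. *)
Lemma d_monotone_incr (B : Z) (s : seq (vtx k)) :
  (exists i : 'I_k, d_monotone (dir i) (map (@point k) s)) ->
  exists i : Z, (B <= i < B + 2 * K)%Z /\ strictly_incr (map (proj i) s).
Proof.
have [KH H1] := K_double.
have norm i : strictly_incr (map (proj i) s) ->
    exists i, (B <= i < B + 2 * K)%Z /\ strictly_incr (map (proj i) s).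
  move=> incr; exists (B + (i - B) mod (2 * K))%Z.
  have := Z.mod_pos_bound (i - B) (2 * K) ltac:(lia).
  split; first lia.
  congr (strictly_incr _): incr; apply: eq_map => v.
  rewrite -(proj_shift (B + _) ((i - B) / (2 * K))); congr proj.
  by have := Z.div_mod (i - B) (2 * K) ltac:(lia); lia.
move=> [i [_]].
have -> : map (fun p => dot p (dir i)) (map (@point k) s) = map (proj (Z.of_nat i)) s.
  by rewrite -map_comp; apply: eq_map => v /=; rewrite /proj /dir /dirZ !INR_IZR_INZ.
case=> [incr|/strictly_decr_opp decr]; first exact: (norm _ incr).
apply: (norm (Z.of_nat i + K)%Z); congr (strictly_incr _): decr.
by rewrite -map_comp; apply: eq_map => v; rewrite proj_opp.
Qed.

Lemma incr_d_monotone (i : Z) (s : seq (vtx k)) :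
  strictly_incr (map (proj i) s) ->
  exists j : 'I_k, d_monotone (dir j) (map (@point k) s).
Proof.
have [KH H1] := K_double => incr.
have jP : (Z.to_nat (i mod K) < k)%N.
  by have := Z.mod_pos_bound i K ltac:(lia); rewrite /K; lia.
exists (Ordinal jP).
have projE (v : vtx k) : dot (point v) (dir (Ordinal jP)) = proj (i mod K) v.
  rewrite /proj /dir /dirZ /= INR_IZR_INZ Z2Nat.id //.
  by have := Z.mod_pos_bound i K ltac:(lia); lia.
have incr_or_decr : strictly_incr (map (proj (i mod K)) s) \/
    strictly_decr (map (proj (i mod K)) s).
  have := Z.div_mod i K ltac:(lia); set q := (i / K)%Z => iE.
  (* Each half turn changes the sign of the projection, so the parity of the quotient decides
     between increasing and decreasing. *)
  have [qE|qE] : (q = 2 * (q / 2) \/ q = 2 * (q / 2) + 1)%Z.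
    by have := Z.div_mod q 2 ltac:(lia); have := Z.mod_pos_bound q 2 ltac:(lia); lia.
  - left; congr (strictly_incr _): incr; apply: eq_map => v.
    rewrite -(proj_shift (i mod K) (q / 2)); congr proj; nia.
  - right; have -> : map (proj (i mod K)) s = map Ropp (map (proj i) s).
      rewrite -map_comp; apply: eq_map => v /=; rewrite -proj_opp.
      rewrite -(proj_shift (i mod K) (q / 2 + 1)); congr proj; nia.
    exact: strictly_incr_opp.
have projs : map (fun p => dot p (dir (Ordinal jP))) (map (@point k) s) =
    map (proj (i mod K)) s.
  by rewrite -map_comp; apply: eq_map => v; rewrite /= projE.
split; last by rewrite projs.
move=> a b; rewrite size_map => sa sb ab.
rewrite !(nth_map None) // !projE -!(nth_map None R0) //.
have lt_neq l x y : strictly_incr l -> (x < y < size l)%N -> nth R0 l x <> nth R0 l y.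
  by move=> incr_l /(strictly_incr_lt R0 incr_l); lra.
case: incr_or_decr => [incr'|/strictly_decr_opp decr'].
  case: (ltngtP a b) => [h|h|//]; last apply: not_eq_sym;
    by apply: lt_neq => //; rewrite size_map h.
case: (ltngtP a b) => [h|h|//] eq_ab.
  have := @lt_neq _ a b decr'; rewrite !size_map h sb => /(_ isT); apply.
  by rewrite !(nth_map R0) ?size_map // eq_ab.
have := @lt_neq _ b a decr'; rewrite !size_map h sa => /(_ isT); apply.
by rewrite !(nth_map R0) ?size_map // eq_ab.
Qed.

Lemma dist_vert (y z : Z) :
  dist (point (vert y)) (point (vert z)) =
  (2 * Rabs (sin (IZR (y - z) * PI / (2 * INR k))))%R.
Proof.
have k0 := INR_k_gt0; rewrite !point_vert /dist /=.
set a := angle y; set b := angle z; set c := (_ / _)%R.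
have eab : (a - b = 2 * c)%R.
  by rewrite /a /b /c /angle minus_IZR !plus_IZR !mult_IZR; field; lra.
have /(congr1 cos) := eab; rewrite cos_minus cos_2a_sin => ec.
have := sin2_cos2 a; have := sin2_cos2 b; rewrite /Rsqr => sb sa.
rewrite -[2%R in RHS]Rabs_right; last lra.
rewrite -Rabs_mult -sqrt_Rsqr_abs; congr sqrt; rewrite /Rsqr; nra.
Qed.

Lemma dist_root (z : Z) : dist (point (vert z)) (point (None : vtx k)) = 1%R.
Proof.
rewrite point_vert /dist /= -[RHS]sqrt_1; congr sqrt.
by have := sin2_cos2 (angle z); rewrite /Rsqr; lra.
Qed.

End Fan.

(** * Branches of a monotone tree *)

Lemma strictly_incr_cat (T : Type) (f : T -> R) s1 x s2 y s3 :
  strictly_incr (map f (s1 ++ x :: s2 ++ y :: s3)) -> (f x < f y)%R.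
Proof.
move=> /(strictly_incr_lt R0) incr.
have := incr (size s1) ((size s1) + (size s2).+1)%N.
rewrite size_map !size_cat /= size_cat /= => /(_ ltac:(lia)).
rewrite !(nth_map x) ?size_cat /= ?size_cat /=; try lia.
rewrite !nth_cat ltnn subnn /= ifN; last lia.
by rewrite addKn /= nth_cat ltnn subnn.
Qed.

Section MonotoneTree.
Context (k : nat) (k_gt1 : (1 < k)%N) (k_even : ~~ odd k).
Context (E : {set vtx k * vtx k}) (monoE : D_monotone_spanning_tree E).

Let K := Z.of_nat k.
Let H := Z.of_nat k./2.
Let treeE : is_tree E := proj1 monoE.
Let KH : (K = 2 * H /\ 1 <= H)%Z := K_double k_gt1 k_even.
Local Notation vert := (vert k_gt1 k_even).
Local Notation par := (parent None treeE).
Local Notation br := (branch None treeE).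
Local Notation proj := (@proj k).
Local Notation cosq := (cosq k).

#[local] Hint Resolve vert_neq : core.

Lemma path_incr B u v s : is_path E u v s ->
  exists i, (B <= i < B + 2 * K)%Z /\ strictly_incr (map (proj i) (u :: s)).
Proof. by move=> /(proj2 monoE)/(d_monotone_incr k_gt1 k_even B). Qed.

Lemma branch_self v : v != None -> par v = None -> br v = v.
Proof. exact: branch_child. Qed.

(** The path from [v] to [u] passes through [o], then [br u], and reaches [u] from [par u];
    [par u != None] makes [br u] differ from [u]. *)
Lemma branch_order B u v : u != None -> par u != None -> v != None -> br v != br u ->
  exists i, (B <= i < B + 2 * K)%Z /\ (proj i v < proj i None)%R /\
    (proj i None < proj i (br u))%R /\ (proj i (br u) < proj i u)%R /\
    (proj i (par u) < proj i u)%R.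
Proof.
move=> uo po vo buv.
have [s [es /(path_incr B)[i [iB]]]] := path_via_root vo uo buv.
rewrite -es => incr; exists i; split=> //.
have [t et] := root_path_branch uo po.
have ev := root_path_rcons treeE vo.
move: (incr); rewrite et ev -rcons_cons rev_rcons rev_cons cat_cons cat_rcons => incr1.
split; first exact: (strictly_incr_cat (s1 := [::]) incr1).
split; first exact: (strictly_incr_cat (s1 := v :: _) (s2 := [::]) incr1).
split.
  apply: (strictly_incr_cat (s1 := v :: rcons (rev (root_path None treeE (par v))) None)
    (s2 := t) (s3 := [::])).
  by move: incr1; rewrite cats1 cat_cons cat_rcons.
have eu : root_path None treeE u = root_path None treeE (par (par u)) ++ [:: par u; u].
  by rewrite (root_path_rcons treeE uo) (root_path_rcons treeE po) -!cats1 -catA.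
move: incr; rewrite eu catA => incr.
exact: (strictly_incr_cat (s2 := [::]) (s3 := [::]) incr).
Qed.

(** The root path of the antipode would start with [o] and [vert z], so both antipodal points would
    project beyond [o] in one direction. *)
Lemma antipode_branch z : br (vert (z + K)) <> vert z.
Proof.
have [KE H1] := KH.
move=> bz; have [po|po] := eqVneq (par (vert (z + K))) None.
  by move: bz; rewrite branch_self // => /vert_inj; lia.
have [s es] := root_path_branch (vert_neq k_gt1 k_even (z + K)) po.
have [i [iB]] := path_incr (z - K) (root_pathP None treeE (vert (z + K))).
rewrite es bz -cats1 => incr.
have := strictly_incr_cat (s1 := [::]) (s2 := [::]) incr.
have := strictly_incr_cat (s1 := [:: None]) (s2 := s) (s3 := [::]) incr.
have [m [mK [mz ->]]] := proj_vert k_gt1 k_even (i := i) (z := z) ltac:(lia).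
have [n [nK [nz ->]]] := proj_vert k_gt1 k_even (i := i) (z := (z + K)%Z) ltac:(lia).
rewrite (proj_root k_gt1 k_even).
move=> /(cosq_lt k_gt1) h1 /(cosq_lt k_gt1) h2; lia.
Qed.

Ltac rank i z m :=
  have [m [? [? ->]]] := proj_vert k_gt1 k_even (i := i) (z := z) ltac:(lia).

(* The path leaving the branch from [v_(c-x)] to a neighbour outside of it makes
   the separating line pass right next to [v_(c-x)]; yet [v_c] comes between them
   on this path, so it must be the vertex next to the line at its other end. *)
Lemma branch_boundary c x : par (vert c) = None -> (0 < x < 2 * K)%Z ->
  br (vert (c - x)) = vert c ->
  br (vert (c - (x - 1))) = vert c /\
  (br (vert (c - (x + 1))) = vert c \/ x = K - 1)%Z.
Proof.
have [KE H1] := KH => pc xK bx.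
have px : par (vert (c - x)) != None.
  by apply/eqP => px; move: bx; rewrite branch_self // => /vert_inj; lia.
(* If the neighbour on side [e] lies outside the branch, the separating line runs between it and
   [v_(c-x)]. This fixes the rank of [v_(c-x)]: [3H - 1] for [e = 1], [3H - 2] for [e = -1]. The
   rank of [v_c] is larger but still inner. *)
have sep e : (Z.abs e = 1)%Z -> br (vert (c - x + e)) != vert c ->
    exists2 i, (c - x - i = (if e =? 1 then H - 1 else - H))%Z &
    (exists m, (- H <= m < H)%Z /\ (m = c - i \/ m = c - i + 2 * K \/ m = c - i - 2 * K)%Z
    /\ (Z.abs (3 * (c - x - i) + 2) < Z.abs (3 * m + 2)))%Z.
  move=> e1; rewrite -bx => be.
  have [i [iB]] := branch_order (u := vert (c - x)) (v := vert (c - x + e))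
    (c - x - K + 1) (vert_neq _ _ _) px (vert_neq _ _ _) be.
  rewrite bx (proj_root k_gt1 k_even) => -[+ [+ [+ _]]].
  rewrite (proj_window k_gt1 k_even i (c - x)) (proj_window k_gt1 k_even i (c - x + e)).
  rank i c m => h1 h2 h3.
  have m2 := cosq_inner k_gt1 k_even (m := (c - x - i)%Z) ltac:(lia) (Rlt_trans _ _ _ h2 h3).
  have m3 := cosq_outer k_gt1 k_even h1.
  have m1 := cosq_inner k_gt1 k_even (m := m) ltac:(lia) h2.
  move: h3 => /(cosq_lt k_gt1) h3; exists i.
    by case: Z.eqb_spec => e1'; clear -KE H1 e1 e1' m2 m3; lia.
  by exists m; split=> //; split=> //; apply: h3; clear -KE H1 m2 m1; lia.
split; [apply/eqP/negPn/negP => bx'|have [->|bx'] := eqVneq (br (vert (c - (x + 1)))) (vert c)];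
  [|by left|right].
(* No inner rank exceeds [3H - 1]. *)
- have [|i /= li [m [mH [mc mlt]]]] := sep 1%Z erefl; last by clear -KE H1 li mH mlt; lia.
  by have -> : (c - x + 1 = c - (x - 1))%Z by lia.
(* The only inner rank above [3H - 2] is [3H - 1], at the other end of the half-circle, whence
   [x = K - 1]. *)
- have [|i /= li [m [mH [mc mlt]]]] := sep (-1)%Z erefl; last first.
    have m1 : (m = H - 1)%Z by clear -KE H1 li mH mlt; lia.
    by clear -KE H1 li m1 mc xK; lia.
  by have -> : (c - x + -1 = c - (x + 1))%Z by lia.
Qed.

(** By [branch_boundary], membership passes from [x] down to [x - 1], and up to [x + 1] as long as
    [x] is not [K - 1]. A member with [x >= K] would, going down, bring in the antipode of [v_c]. *)
Lemma branch_shape c x0 : par (vert c) = None -> (0 < x0 < 2 * K)%Z ->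
  br (vert (c - x0)) = vert c ->
  forall x, (0 <= x < 2 * K)%Z -> br (vert (c - x)) = vert c <-> (x < K)%Z.
Proof.
have [KE H1] := KH => pc x0K b0.
have down (n : nat) x : (Z.of_nat n <= x < 2 * K)%Z ->
    br (vert (c - x)) = vert c -> br (vert (c - (x - Z.of_nat n))) = vert c.
  elim: n x => [|n IH] x xn bx; first by rewrite Z.sub_0_r.
  have [bx1 _] := branch_boundary (x := x) pc ltac:(lia) bx.
  have -> : (c - (x - Z.of_nat n.+1) = c - (x - 1 - Z.of_nat n))%Z by lia.
  by apply: IH => //; lia.
have lt_K x : (0 <= x < 2 * K)%Z -> br (vert (c - x)) = vert c -> (x < K)%Z.
  move=> xK bx; case: (Z_lt_le_dec x K) => // Kx.
  have := down (Z.to_nat (x - K)) x ltac:(lia) bx.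
  have -> : (c - (x - Z.of_nat (Z.to_nat (x - K))) = c - K)%Z by lia.
  have -> : vert c = vert (c - K + K)%Z by congr vert; lia.
  move=> bxK; exfalso; apply: (antipode_branch (z := c)%Z).
  rewrite -(vert_shift k_gt1 k_even _ (-1)).
  have -> : (c + K + -1 * (2 * K) = c - K)%Z by lia.
  by rewrite bxK; congr vert; lia.
have up (n : nat) : (x0 + Z.of_nat n < K)%Z -> br (vert (c - (x0 + Z.of_nat n))) = vert c.
  elim: n => [|n IH] xn; first by rewrite Z.add_0_r.
  have [_ [|]] := branch_boundary pc (x := (x0 + Z.of_nat n)%Z)
    ltac:(lia) (IH ltac:(lia)); last lia.
  by have -> : (x0 + Z.of_nat n.+1 = x0 + Z.of_nat n + 1)%Z by lia.
have x0K' := lt_K x0 ltac:(lia) b0.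
have top : br (vert (c - (K - 1))) = vert c.
  have := up (Z.to_nat (K - 1 - x0)) ltac:(lia).
  by have -> : (x0 + Z.of_nat (Z.to_nat (K - 1 - x0)) = K - 1)%Z by lia.
move=> x xK; split=> [|xK']; first exact: lt_K.
have := down (Z.to_nat (K - 1 - x)) (K - 1)%Z ltac:(lia) top.
by have -> : (K - 1 - Z.of_nat (Z.to_nat (K - 1 - x)) = x)%Z by lia.
Qed.

(** The path between the two vertices avoids [o], and its inner vertices project strictly between
    its ends. Only one vertex can do so, hence there is at most one inner vertex. *)
Lemma consecutive_path y : br (vert y) = br (vert (y + 1)) ->
  (vert y, vert (y + 1)) \in E \/
  exists n, (vert y, vert (y + 2 * n)) \in E /\ (vert (y + 2 * n), vert (y + 1)) \in E.
Proof.
have [KE H1] := KH => byy.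
have [[s sP] _] := proj2 treeE (vert y) (vert (y + 1)).
have os := path_same_branch (o := None) (u := vert y) (v := vert (y + 1))
  sP (vert_neq _ _ _) (vert_neq _ _ _) byy.
have [i [iB]] := path_incr (y - K + 1) sP.
case: sP => [+ []]; case/lastP: s os => [|r z] os.
  by move=> _ /vert_inj; lia.
rewrite last_rcons => pr ez; rewrite {z}ez in os pr *; rewrite -rcons_cons rcons_uniq.
move=> /andP[_ /= /andP[_ ur]] incr.
(* With [a = y - i], the only rank strictly between [|3a + 2|] and [|3a + 5|] that can occur is
   [|3a + 4|], attained at [m = -a - 2]; this is the index [2i - y - 2], of the parity of [y]. *)
have rE z : z \in r -> z = vert (y + 2 * (i - y - 1)).
  move=> zr; have zo : z != None.
    by apply: contraNneq os => <-; rewrite mem_rcons inE zr orbT.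
  have [t [tB zt]] := vertP k_gt1 k_even (i - K) zo; rewrite zt.
  case/splitPr: zr incr => r1 r2; rewrite -cats1 -catA cat_cons => incr.
  have := strictly_incr_cat (s1 := [::]) (s2 := r1) (s3 := r2 ++ [:: vert (y + 1)]) incr.
  have := strictly_incr_cat (s1 := vert y :: r1) (s2 := r2) (s3 := [::]) incr.
  rewrite zt (proj_window k_gt1 k_even i y) (proj_window k_gt1 k_even i t).
  rank i (y + 1)%Z m3.
  move=> /(cosq_lt k_gt1) h1 /(cosq_lt k_gt1) h2; congr vert.
  have {}h1 := h1 ltac:(lia) ltac:(lia); have {}h2 := h2 ltac:(lia) ltac:(lia); lia.
case: r rE ur pr {os incr} => [|z [|z' r]] rE /=.
- move=> _ /andP[e _]; left; exact: e.
- move=> _ /and3P[]; rewrite (rE z) ?mem_head // /adj => e1 e2 _.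
  right; exists (i - y - 1)%Z; split; [exact: e1|exact: e2].
- by rewrite (rE z) ?mem_head // (rE z') ?inE ?eqxx ?orbT.
Qed.

(** A counterclockwise step increases the projection only on the half-circle that precedes the
    direction [i]. *)
Lemma proj_step i z : (- K <= z - i < K)%Z ->
  (proj i (vert (z - 1)) < proj i (vert z))%R -> (z - i < 0)%Z.
Proof.
have [KE H1] := KH => zi; rewrite (proj_window k_gt1 k_even i z).
by rank i (z - 1)%Z m => /(cosq_lt k_gt1); lia.
Qed.

(** The outer edges are both counterclockwise steps, so [X] and [Y + 1] lie on the rising
    half-circle of the direction; there [Y], being behind [X], projects below it, against the middle
    edge. The bound 3 keeps the four vertices distinct. *)
Lemma no_fold X Y : (3 <= X - Y < K)%Z ->
  (vert (X - 1), vert X) \in E -> (vert X, vert Y) \in E ->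
  (vert Y, vert (Y + 1)) \in E -> False.
Proof.
have [KE H1] := KH => XY e1 e2 e3.
have vneq y z : (- (2 * K) < y - z < 2 * K /\ y <> z)%Z -> (vert y == vert z) = false.
  by move=> [yz neq]; apply/eqP => /vert_inj; lia.
have P : is_path E (vert (X - 1)) (vert (Y + 1)) [:: vert X; vert Y; vert (Y + 1)].
  by split; rewrite /= /adj ?e1 ?e2 ?e3 //; split; rewrite // !inE !vneq //; lia.
have [i [iB]] := path_incr (X - K + 1) P.
rewrite [map _ _]/= => -[hX [hXY [hY _]]].
have Xi := proj_step (i := i) (z := X) ltac:(lia) hX.
(* Otherwise [Y + 1], moved by one turn, would lie past the direction, on the falling
   half-circle. *)
have Yi : (- K <= Y + 1 - i)%Z.
  case: (Z_lt_le_dec (Y + 1 - i) (- K)) => // lt_K.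
  have := proj_step (i := i) (z := (Y + 1 + 1 * (2 * K))%Z) ltac:(lia).
  have -> : (Y + 1 + 1 * (2 * K) - 1 = Y + 1 * (2 * K))%Z by lia.
  by rewrite !vert_shift => /(_ hY); lia.
move: hXY; rewrite (proj_window k_gt1 k_even i X).
by rank i Y m => /(cosq_lt k_gt1) h; have {}h := h ltac:(lia) ltac:(lia); lia.
Qed.

End MonotoneTree.

(** * The zigzag *)

Section LargeBranch.
Context (k : nat) (k_gt1 : (1 < k)%N) (k_even : ~~ odd k).
Context (E : {set vtx k * vtx k}) (monoE : D_monotone_spanning_tree E).

Let K := Z.of_nat k.
Let H := Z.of_nat k./2.
Let treeE : is_tree E := proj1 monoE.
Let KH : (K = 2 * H /\ 1 <= H)%Z := K_double k_gt1 k_even.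
Local Notation vert := (vert k_gt1 k_even).
Local Notation par := (parent None treeE).
Local Notation br := (branch None treeE).
Local Notation proj := (@proj k).

Context (c : Z) (root_c : par (vert c) = None).
Hypothesis branch_c :
  forall x, (0 <= x < 2 * K)%Z -> br (vert (c - x)) = vert c <-> (x < K)%Z.

(** Offsets from [c] in zigzag order: even positions count up from 0, odd ones count down from
    [K - 1]. *)
Definition zig (t : nat) : Z :=
  if odd t then (K - 1 - Z.of_nat t./2)%Z else Z.of_nat t./2.

(** Linear equations without halving, among which parity selects, suit [lia]. *)
Lemma zigP t : (t < k)%N -> (0 <= zig t < K /\
  (2 * zig t = Z.of_nat t \/ 2 * zig t = 2 * K - 1 - Z.of_nat t))%Z.
Proof. by have [KE H1] := KH; rewrite /zig /K; case: ifP; lia. Qed.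

Lemma zig_onto x : (0 <= x < K)%Z -> exists2 t, (t < k)%N & zig t = x.
Proof.
have [KE H1] := KH => xK; have [lo|hi] := Z_lt_le_dec x H.
  exists (Z.to_nat x).*2; first by move: KE lo; rewrite /K; lia.
  by rewrite /zig odd_double doubleK; lia.
exists (Z.to_nat (K - 1 - x)).*2.+1; first by move: KE xK hi; rewrite /K; lia.
by rewrite /zig /= odd_double /= uphalf_double; lia.
Qed.

Definition zvert (t : nat) : vtx k := vert (c - zig t).

Lemma zvert_neq t : zvert t != None.
Proof. exact: vert_neq. Qed.

#[local] Hint Resolve vert_neq zvert_neq : core.

Lemma zvert_inj s t : (s < k)%N -> (t < k)%N -> zvert s = zvert t -> s = t.
Proof.
have [KE H1] := KH => sk tk; have zs := zigP sk; have zt := zigP tk.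
move=> /(vert_inj (y := (c - zig s)%Z) (z := (c - zig t)%Z)); lia.
Qed.

Lemma zvert_branch t : (t < k)%N -> br (zvert t) = vert c.
Proof. by have [KE H1] := KH => /zigP zt; apply/branch_c; lia. Qed.

Lemma branch_zvert v : v != None -> br v = vert c -> exists2 t, (t < k)%N & v = zvert t.
Proof.
have [KE H1] := KH => vo.
have [z [zc ->]] := vertP k_gt1 k_even (c - 2 * K + 1) vo.
have -> : z = (c - (c - z))%Z by lia.
move=> /(proj1 (branch_c (x := (c - z)%Z) ltac:(lia))) zK.
by have [t tk tz] := zig_onto (x := (c - z)%Z) ltac:(lia); exists t; rewrite // /zvert tz.
Qed.

Lemma zvert0 : zvert 0 = vert c.
Proof. by rewrite /zvert /zig /= Z.sub_0_r. Qed.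

(** The vertex [v_(c+1)] is outside the branch, so the path from it to any deeper vertex of the
    branch must increase in one fixed direction. In that direction the branch projects in exactly
    the zigzag order, and a parent projects below its child. *)
Lemma zvert_parent t : (0 < t < k)%N -> exists2 s, (s < t)%N & par (zvert t) = zvert s.
Proof.
have [KE H1] := KH => /andP[t0 tk].
have po : par (zvert t) != None.
  apply/eqP => /(branch_self (monoE := monoE) (v := zvert t) (zvert_neq t)).
  rewrite zvert_branch // -zvert0 => /zvert_inj; lia.
have bp : br (par (zvert t)) = vert c by rewrite -branch_parent // zvert_branch.
have [s sk ps] := branch_zvert po bp; exists s => //.
have bc1 : br (vert (c + 1)) != br (zvert t).
  rewrite zvert_branch //; apply/eqP.
  rewrite -(vert_shift k_gt1 k_even _ (-1)).
  have -> : (c + 1 + -1 * (2 * Z.of_nat k) = c - (2 * K - 1))%Z by rewrite -/K; lia.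
  by move=> /(proj1 (branch_c (x := (2 * K - 1)%Z) ltac:(lia))); lia.
have [i [iB []]] := 
  @branch_order k k_gt1 k_even E monoE (c - K + 1) (zvert t) (vert (c + 1))
    (zvert_neq t) po (vert_neq _ _ _) bc1.
rewrite zvert_branch // ps (proj_root k_gt1 k_even) => h1 [h2 [_]].
move: h1 h2; rewrite (proj_window k_gt1 k_even i c) (proj_window k_gt1 k_even i (c + 1)).
move=> /(cosq_outer k_gt1 k_even) h1 /(cosq_inner k_gt1 k_even) h2.
(* The line separates [c] from [c + 1], so [c] is the last index on the positive side:
   [c - i = H - 1]. *)
have {h1 h2}iE : (i = c - H + 1)%Z by have := h2 ltac:(lia); clear h2; lia.
rewrite /zvert (proj_window k_gt1 k_even i) (proj_window k_gt1 k_even i (c - zig t)).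
have zs := zigP sk; have zt := zigP tk.
by move=> /(cosq_lt k_gt1) h; have {}h := h ltac:(lia) ltac:(lia); lia.
Qed.

(** Positions [t] and [t + 2] are neighbours on the polygon, so [consecutive_path] applies; a middle
    vertex stays in the branch and so has a position [r]. *)
Lemma zvert_consecutive t : (t.+2 < k)%N ->
  (zvert t, zvert t.+2) \in E \/
  exists2 r, (r < k)%N & [/\ (zvert t, zvert r) \in E, (zvert r, zvert t.+2) \in E &
    exists n, zig r = (Z.max (zig t) (zig t.+2) + 2 * n)%Z].
Proof.
have [KE H1] := KH => tk.
have zt := zigP (ltnW (ltnW tk)); have zt2 := zigP tk.
have bt := zvert_branch (ltnW (ltnW tk)); have bt2 := zvert_branch tk.
set y := (c - Z.max (zig t) (zig t.+2))%Z.
have pairE : (zvert t = vert y /\ zvert t.+2 = vert (y + 1)) \/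
    (zvert t = vert (y + 1) /\ zvert t.+2 = vert y).
  have [?|?] : (zig t.+2 = zig t - 1 \/ zig t.+2 = zig t + 1)%Z by lia.
    by left; rewrite /zvert; split; congr vert; lia.
  by right; rewrite /zvert; split; congr vert; lia.
have by1 : br (vert y) = br (vert (y + 1)).
  by case: pairE => -[<- <-]; rewrite bt bt2.
have mid n : (vert y, vert (y + 2 * n)) \in E ->
    exists2 r, (r < k)%N & zvert r = vert (y + 2 * n) /\
      exists n, zig r = (Z.max (zig t) (zig t.+2) + 2 * n)%Z.
  move=> e; have bn : br (vert (y + 2 * n)) = vert c.
    rewrite -(edge_branch (o := None) treeE e (vert_neq _ _ _) (vert_neq _ _ _)).
    by case: pairE => -[h1 h2]; [rewrite -h1 bt|rewrite -h2 bt2].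
  have [r rk er] := branch_zvert (v := vert (y + 2 * n)) (vert_neq _ _ _) bn.
  exists r; first exact: rk.
  split; first exact: (esym er).
  (* Indices are known modulo [2 * K] only, which is even and so preserves the parity. *)
  have [m em] := vert_eq er; exists (- (n - m * K))%Z; lia.
case: (consecutive_path by1) => [e|[n [e1 e2]]].
  left; case: pairE => -[-> ->]; first exact: e.
  rewrite (edge_sym treeE); exact: e.
right; have [r rk [er zr]] := mid n e1; exists r; first exact: rk.
rewrite er; case: pairE => -[-> ->]; split; try exact: zr.
- exact: e1.
- exact: e2.
- rewrite (edge_sym treeE); exact: e2.
- rewrite (edge_sym treeE); exact: e1.
Qed.

(** Parents come earlier in the zigzag, so the later end of an edge is the child. *)
Lemma zvert_edge_lt s t : (s < k)%N -> (t < s)%N ->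
  (zvert s, zvert t) \in E -> par (zvert s) = zvert t.
Proof.
move=> sk ts /(edge_parent None treeE)[[_ pt]|[_ //]]; case: (posnP t) => t0.
  by move: pt; rewrite t0 zvert0 root_c.
have [u ut pu] := zvert_parent (t := t) ltac:(lia).
by move: pt; rewrite pu => /zvert_inj; lia.
Qed.

Lemma zvert_edge_gt s t : (s < k)%N -> (t < s)%N ->
  (zvert t, zvert s) \in E -> par (zvert s) = zvert t.
Proof. move=> sk ts; rewrite (edge_sym treeE); exact: zvert_edge_lt. Qed.

Lemma zvert_edge_neq s t : (zvert s, zvert t) \in E -> s != t.
Proof. by move/(edge_neq treeE); apply: contraNneq => ->. Qed.

(** A common neighbour [r] beyond [t + 2] would have two parents, and one before [t] would be the
    parent [t - 1] of [t], which has the wrong parity. Only [r = t + 1] is left, besides a direct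
    edge. *)
Lemma zvert_step t : (t.+2 < k)%N -> par (zvert t) = zvert t.-1 \/ t = 0 ->
  (par (zvert t.+1) = zvert t /\ par (zvert t.+2) = zvert t.+1) \/
  par (zvert t.+2) = zvert t.
Proof.
have [KE H1] := KH => tk pt.
case: (zvert_consecutive tk) => [e|[r rk [e1 e2 [n zr]]]].
  right; exact: (zvert_edge_gt tk (ltnW (ltnSn _)) e).
have r1 := zvert_edge_neq e1; have r2 := zvert_edge_neq e2.
case: (ltngtP r t.+2) r2 => // rt _.
  have p2 := zvert_edge_gt tk rt e2.
  case: (ltngtP r t) r1 => // rt' _.
    have pr : par (zvert t) = zvert r by apply: zvert_edge_lt e1; lia.
    case: pt => [pt|t0]; last by move: rt'; rewrite t0.
    have rE : r = t.-1 by move: pt; rewrite pr => /zvert_inj; lia.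
    (* Since [K] is even, the offset of [t - 1] differs from the larger of the two offsets by an odd
       number. *)
    by have := zigP rk; have := zigP tk; have := zigP (ltnW (ltnW tk));
      clear -KE H1 rt' rE zr tk; lia.
  left; have re : r = t.+1 by lia.
  split; first by rewrite -re (zvert_edge_gt rk rt' e1).
  by rewrite p2 re.
have pr := zvert_edge_lt rk rt e2.
have pr' := zvert_edge_gt rk (ltnW (ltnW rt)) e1.
by move: pr; rewrite pr' => /zvert_inj; lia.
Qed.

(** If [t + 2] hung from [t], then [t + 3] would hang from [t + 1], and the path
    [t + 2, t, t + 1, t + 3] would be a fold excluded by [no_fold]. The argument looks one position
    ahead, so the last vertex escapes it. *)
Lemma zvert_chain t : (t.+1 < k)%N -> par (zvert t) = zvert t.-1 \/ t = 0.
Proof.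
have [KE H1] := KH.
elim/ltn_ind: t => -[|[|t]] IH tk; [by right|left|left].
  have [s s1 ->] := zvert_parent (t := 1) ltac:(lia).
  by case: s s1.
have [p1|//] := IH t.+1 ltac:(lia) ltac:(lia).
have [[_ //]|p2] := zvert_step (t := t) ltac:(lia) (IH t ltac:(lia) ltac:(lia)).
have [[p2' _]|p3] := zvert_step (t := t.+1) ltac:(lia) (or_introl p1).
  by move: p2; rewrite p2' => /zvert_inj; lia.
have e1 := parent_edge treeE (zvert_neq t.+1); rewrite p1 /= in e1.
have e2 := parent_edge treeE (zvert_neq t.+2); rewrite p2 in e2.
have e3 := parent_edge treeE (zvert_neq t.+3); rewrite p3 in e3.
exfalso.
have z0 := zigP (t := t) ltac:(lia); have z1 := zigP (t := t.+1) ltac:(lia).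
have z2 := zigP (t := t.+2) ltac:(lia); have z3 := zigP (t := t.+3) ltac:(lia).
(* The two cases are the parities of [t]: they decide which of the edges at the ends of the fold
   must be reversed. *)
have [[h1 h2]|[h1 h2]] : ((zig t.+2 = zig t + 1 /\ zig t.+3 = zig t.+1 - 1) \/
    (zig t.+2 = zig t - 1 /\ zig t.+3 = zig t.+1 + 1))%Z by lia.
- rewrite (edge_sym treeE) in e2.
  apply: (no_fold monoE (X := (c - zig t)%Z) (Y := (c - zig t.+1)%Z)); first lia.
  + have -> : (c - zig t - 1 = c - zig t.+2)%Z by lia.
    exact: e2.
  + exact: e1.
  + have -> : (c - zig t.+1 + 1 = c - zig t.+3)%Z by lia.
    exact: e3.
- rewrite (edge_sym treeE) in e1; rewrite (edge_sym treeE) in e3.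
  apply: (no_fold monoE (X := (c - zig t.+1)%Z) (Y := (c - zig t)%Z)); first lia.
  + have -> : (c - zig t.+1 - 1 = c - zig t.+3)%Z by lia.
    exact: e3.
  + exact: e1.
  + have -> : (c - zig t + 1 = c - zig t.+2)%Z by lia.
    exact: e2.
Qed.

Lemma dist_zvert s t (d : nat) : (d < k)%N ->
  (zig s - zig t = Z.of_nat d \/ zig t - zig s = Z.of_nat d)%Z ->
  dist (point (zvert s)) (point (zvert t)) = (2 * sin (INR d * PI / (2 * INR k)))%R.
Proof.
move=> dk zst; rewrite dist_vert; congr Rmult.
have k0 := INR_k_gt0 k_gt1; have pi0 := PI_RGT_0.
have /lt_INR dk' : (d < k)%coq_nat by lia.
have d0 := pos_INR d.
have sin0 : (0 <= sin (INR d * PI / (2 * INR k)))%R.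
  apply: sin_ge_0; first by apply: Rle_mult_inv_pos; nra.
  apply/(Rmult_le_reg_r (2 * INR k)); first lra.
  have -> : (INR d * PI / (2 * INR k) * (2 * INR k) = INR d * PI)%R by field; lra.
  nra.
have [->|->] : (c - zig s - (c - zig t) = Z.of_nat d \/
    c - zig s - (c - zig t) = - Z.of_nat d)%Z by lia.
  by rewrite -INR_IZR_INZ Rabs_pos_eq.
rewrite opp_IZR -INR_IZR_INZ.
have -> : (- INR d * PI / (2 * INR k) = - (INR d * PI / (2 * INR k)))%R by field; lra.
by rewrite sin_neg Rabs_Ropp Rabs_pos_eq.
Qed.

(** Positions [t - 1] and [t] are [k - t] steps apart on the polygon. The last vertex may hang from
    position [k - 3] instead, which is one step away just like position [k - 2], so the formula
    holds for it too. *)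
Lemma dist_parent t : (0 < t < k)%N ->
  dist (point (zvert t)) (point (par (zvert t))) =
  (2 * sin (INR (k - t) * PI / (2 * INR k)))%R.
Proof.
have [KE H1] := KH => /andP[t0 tk].
have zt := zigP tk; have zt1 := zigP (t := t.-1) ltac:(lia).
have chain : par (zvert t) = zvert t.-1 ->
    dist (point (zvert t)) (point (par (zvert t))) =
    (2 * sin (INR (k - t) * PI / (2 * INR k)))%R.
  by move=> ->; apply: dist_zvert; lia.
case: (ltnP t.+1 k) => [tk1|kt]; first by case: (zvert_chain tk1) => //; lia.
case: t t0 tk kt zt zt1 chain => [|[|t]] // _ tk kt zt zt1 chain.
  have [s s1 p1] := zvert_parent (t := 1) tk.
  have {s1}s0 : s = 0 by lia.
  rewrite s0 in p1.
  exact: chain p1.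
case: (zvert_step tk (zvert_chain (ltnW tk))) => [[_ /chain //]|->].
have zt2 := zigP (t := t) ltac:(lia).
by apply: dist_zvert; lia.
Qed.

End LargeBranch.

(** * Lengths *)

Lemma sum_Rle (I : eqType) (r : seq I) (P : pred I) (F G : I -> R) :
  (forall i, i \in r -> P i -> F i <= G i)%R ->
  (\big[Rplus/0%R]_(i <- r | P i) F i <= \big[Rplus/0%R]_(i <- r | P i) G i)%R.
Proof.
elim: r => [|i r IH] FG; first by rewrite !big_nil; lra.
have := IH (fun j jr => FG j (mem_behead (s := i :: r) jr)).
by rewrite !big_cons; case: ifP => // Pi; have := FG i (mem_head _ _) Pi; lra.
Qed.

Lemma sum_Rlt (I : eqType) (r : seq I) (P : pred I) (F G : I -> R) (i0 : I) :
  (forall i, i \in r -> P i -> F i <= G i)%R ->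
  i0 \in r -> P i0 -> (F i0 < G i0)%R ->
  (\big[Rplus/0%R]_(i <- r | P i) F i < \big[Rplus/0%R]_(i <- r | P i) G i)%R.
Proof.
elim: r => [//|i r IH] FG; rewrite inE => i0r Pi0 lt0; rewrite !big_cons.
have FGr j (jr : j \in r) := FG j (mem_behead (s := i :: r) jr).
have [e|ne] := eqVneq i0 i.
  by rewrite -e Pi0; have := @sum_Rle _ r P F G FGr; lra.
rewrite (negbTE ne) /= in i0r; have := IH FGr i0r Pi0 lt0.
by case: ifP => // Pi; have := FG i (mem_head _ _) Pi; lra.
Qed.

Lemma sum_sin_gt k : (1 < k)%N ->
  (\big[Rplus/0%R]_(1 <= t < k) 1 <
   \big[Rplus/0%R]_(1 <= t < k) (2 * sin (INR (k - t) * PI / (2 * INR k))))%R.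
Proof.
move=> k1; have k0 : (0 < INR k)%R by apply: lt_0_INR; lia.
set S := \big[Rplus/0%R]_(1 <= t < k) _ in |- *.
set T := \big[Rplus/0%R]_(1 <= t < k) _ in |- *.
pose f t := sin (INR t * PI / (2 * INR k)).
have rev_T : T = \big[Rplus/0%R]_(1 <= t < k) (2 * f t)%R.
  rewrite /T big_nat_rev /= !big_nat; apply: eq_bigr => t /andP[t0 tk].
  by rewrite /f; congr (2 * sin (INR _ * PI / _))%R; lia.
have TT : (T + T = \big[Rplus/0%R]_(1 <= t < k) (2 * f (k - t)%N + 2 * f t))%R.
  by rewrite {2}rev_T big_split.
have SS : (S + S = \big[Rplus/0%R]_(1 <= t < k) (1 + 1))%R by rewrite big_split.
(* Doubling both sums pairs [t] with [k - t] without singling out the middle term. *)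
suff : (S + S < T + T)%R by lra.
have lt_t t : t \in index_iota 1 k -> (1 + 1 < 2 * f (k - t)%N + 2 * f t)%R.
  rewrite mem_index_iota => /andP[t0 tk]; rewrite /f minus_INR; last by lia.
  set x := (INR t * PI / (2 * INR k))%R.
  have -> : ((INR k - INR t) * PI / (2 * INR k) = PI / 2 - x)%R by rewrite /x; field; lra.
  rewrite sin_shift.
  have /lt_INR tk' : (t < k)%coq_nat by lia.
  have /lt_INR t0' : (0 < t)%coq_nat by lia.
  have pi0 := PI_RGT_0.
  have x0 : (0 < x)%R by apply: Rdiv_lt_0_compat; rewrite /= in t0'; nra.
  have x1 : (x < PI / 2)%R.
    apply/(Rmult_lt_reg_r (2 * INR k)); first lra.
    have -> : (x * (2 * INR k) = INR t * PI)%R by rewrite /x; field; lra.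
    nra.
  have sx : (0 < sin x)%R by apply: sin_gt_0; lra.
  have cx : (0 < cos x)%R by apply: cos_gt_0; lra.
  (* The square of [sin x + cos x] is [1 + 2 sin x cos x], which exceeds 1. *)
  by have := sin2_cos2 x; rewrite /Rsqr; nra.
rewrite SS TT; apply: (sum_Rlt (i0 := 1)) => //; last apply: lt_t.
- by move=> t /lt_t ? _; lra.
- by rewrite mem_index_iota k1.
- by rewrite mem_index_iota k1.
Qed.

Section Length.
Context (k : nat) (k_gt1 : (1 < k)%N) (k_even : ~~ odd k).
Context (E : {set vtx k * vtx k}) (monoE : D_monotone_spanning_tree E).

Let K := Z.of_nat k.
Let treeE : is_tree E := proj1 monoE.
Local Notation vert := (vert k_gt1 k_even).
Local Notation par := (parent None treeE).
Local Notation br := (branch None treeE).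

Lemma dist_unit (v : vtx k) : v != None -> dist (point v) (point (None : vtx k)) = 1%R.
Proof. by move/(vertP k_gt1 k_even 0) => [z [_ ->]]; exact: dist_root. Qed.

Lemma large_branch_length w : w != None -> par w != None ->
  (\big[Rplus/0%R]_(v : vtx k | (v != None) && (br v == br w)) 1 <
   \big[Rplus/0%R]_(v : vtx k | (v != None) && (br v == br w))
     dist (point v) (point (par v)))%R.
Proof.
have [KE H1] := K_double k_gt1 k_even => wo pw.
have [c [_ cw]] := vertP k_gt1 k_even 0 (branch_neq treeE wo).
have root_c : par (vert c) = None by rewrite -cw; exact: parent_branch.
(* The window ends at [c], so that the offset [c - z] lies in [[0, 2K)]. *)
have [z [zc zw]] := vertP k_gt1 k_even (c - 2 * K + 1) wo.
have zc' : (c - z <> 0)%Z.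
  by move=> zc0; move: pw; rewrite zw (_ : z = c); [rewrite root_c eqxx|lia].
have bz : br (vert (c - (c - z))) = vert c.
  by rewrite -cw zw; congr (br (vert _)); lia.
have branch_c := branch_shape (monoE := monoE) (x0 := (c - z)%Z) root_c ltac:(lia) bz.
pose b (t : 'I_k) := zvert k_gt1 k_even c t.
have b_inj : {in [set: 'I_k] &, injective b}.
  move=> s t _ _ /(zvert_inj (ltn_ord s) (ltn_ord t)); exact: val_inj.
have sumE (F : vtx k -> R) :
    \big[Rplus/0%R]_(v : vtx k | (v != None) && (br v == br w)) F v =
    \big[Rplus/0%R]_(0 <= t < k) F (zvert k_gt1 k_even c t).
  transitivity (\big[Rplus/0%R]_(t in [set: 'I_k]) F (b t)); last first.
    by rewrite big_mkord; apply: eq_bigl => t; rewrite inE.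
  rewrite -(big_imset F b_inj); apply: eq_bigl => v.
  apply/andP/imsetP => [[vo /eqP bv]|[t _ ->]].
    rewrite cw in bv; have [t tk ->] := branch_zvert branch_c vo bv.
    by exists (Ordinal tk).
  by rewrite zvert_neq (zvert_branch branch_c) // cw.
(* Position 0 is the spoke from [o], of length 1; it cancels against its own term. *)
rewrite !sumE !(@big_ltn _ _ _ 0 k) ?zvert0 ?root_c; try lia.
rewrite dist_root; apply: Rplus_lt_compat_l.
rewrite [X in (_ < X)%R]big_nat (eq_bigr _ (fun t tk => dist_parent root_c branch_c tk)).
rewrite -big_nat; exact: sum_sin_gt.
Qed.

Lemma branch_length u :
  (\big[Rplus/0%R]_(v : vtx k | (v != None) && (br v == u)) 1 <=
   \big[Rplus/0%R]_(v : vtx k | (v != None) && (br v == u))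
     dist (point v) (point (par v)))%R.
Proof.
case: (pickP (fun w : vtx k => [&& w != None, par w != None & br w == u])).
  move=> w /and3P[wo pw /eqP <-]; exact/Rlt_le/large_branch_length.
move=> small; apply: sum_Rle => v _ /andP[vo bv].
have /eqP -> : par v == None.
  by apply: contraFT (small v) => pv; rewrite vo pv.
by rewrite dist_unit //; lra.
Qed.

Lemma length_parent : tree_length E =
  \big[Rplus/0%R]_(v : vtx k | v != None) dist (point v) (point (par v)).
Proof.
rewrite /tree_length (sum_edges (F := fun x y => dist (point x) (point y)) None treeE).
  rewrite -Rmult_assoc Rinv_l ?Rmult_1_l; last lra.
  by apply: eq_bigl => v; rewrite !inE.
by move=> x y; rewrite /dist; congr sqrt; ring.
Qed.

(** Both sums are split by branches: no branch is shorter than its spokes, and the branch of [w] is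
    strictly longer. *)
Lemma length_gt w : w != None -> par w != None ->
  (\big[Rplus/0%R]_(v : vtx k | v != None) 1 < tree_length E)%R.
Proof.
move=> wo pw; rewrite length_parent.
rewrite [X in (X < _)%R](partition_big br predT) //.
rewrite [X in (_ < X)%R](partition_big br predT) //.
apply: (sum_Rlt (i0 := br w)); rewrite ?mem_index_enum //.
  by move=> u _ _; exact: branch_length.
exact: large_branch_length.
Qed.

End Length.

(** * The star *)

Lemma in_star k (u v : vtx k) : ((u, v) \in star k) = ((u == None) (+) (v == None)).
Proof. by rewrite inE /=; case: (u == None); case: (v == None). Qed.

Definition star_path k (u v : vtx k) : seq (vtx k) :=
  if u == v then [::] else if (u == None) || (v == None) then [:: v] else [:: None; v].

Lemma star_pathP k (u v : vtx k) : is_path (star k) u v (star_path u v).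
Proof.
rewrite /star_path; have [->|uv] := eqVneq u v; first by split.
case: u v uv => [i|] [j|] //= ij.
- by split; rewrite /= /adj ?in_star //; split=> //=; rewrite !inE ij.
- by split; rewrite /= /adj ?in_star.
- by split; rewrite /= /adj ?in_star.
Qed.

Lemma star_path_root k (v : vtx k) s :
  is_path (star k) None v s -> s = star_path None v.
Proof.
case: s => [[_ [<- _]]|[i|] [|y s]] //; rewrite /is_path /= /adj in_star //=.
- by case=> _ [<- _].
- by rewrite in_star; case: y => [j|] [] // _ [].
- by case.
- by case.
Qed.

(** A path leaving a polygon vertex must step to [o], which reduces the claim to paths from the
    root. *)
Lemma star_path_uniq k (u v : vtx k) s : is_path (star k) u v s -> s = star_path u v.
Proof.
case: u => [i|]; last exact: star_path_root.
case: s => [[_ [<- _]]|x s]; first by rewrite /star_path eqxx.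
case=> /= /andP[]; rewrite /adj in_star; case: x => // _ ps [ls /andP[ns us]].
rewrite (star_path_root (conj ps (conj ls us))) /star_path.
have -> : (Some i == v) = false.
  by apply: contraNF ns => /eqP ->; rewrite -ls mem_last.
by case: v ls => // j _.
Qed.

Lemma star_tree k : is_tree (star k).
Proof.
split; first split.
- by move=> x y; rewrite !in_star addbC.
- by move=> x; rewrite in_star addbb.
move=> u v; split; first by exists (star_path u v); exact: star_pathP.
by move=> s1 s2 /star_path_uniq -> /star_path_uniq ->.
Qed.

Lemma star_degree k : degree (star k) None = k.*2.
Proof.
rewrite /degree -[RHS]card_ord; have := cardsC1 (None : vtx k).
rewrite card_option /= => <-; congr #|pred_of_set _|.
by apply/setP => v; rewrite inE in_star !inE.
Qed.

Section Star.
Context (k : nat) (k_gt1 : (1 < k)%N) (k_even : ~~ odd k).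

Let K := Z.of_nat k.
Let H := Z.of_nat k./2.
Let KH : (K = 2 * H /\ 1 <= H)%Z := K_double k_gt1 k_even.
Local Notation vert := (vert k_gt1 k_even).
Local Notation proj := (@proj k).

Lemma proj_pos i z : (- H <= z - i < H)%Z -> (proj i None < proj i (vert z))%R.
Proof.
have [KE H1] := KH => zi; rewrite (proj_root k_gt1 k_even) proj_window.
by apply: (cosq_decr k_gt1); lia.
Qed.

Lemma proj_neg i z : (H <= z - i < 3 * H)%Z -> (proj i (vert z) < proj i None)%R.
Proof.
have [KE H1] := KH => zi; rewrite (proj_root k_gt1 k_even).
have [m [mK [mz ->]]] := proj_vert k_gt1 k_even (i := i) (z := z) ltac:(lia).
by apply: (cosq_decr k_gt1); lia.
Qed.

(** A path between two polygon vertices only needs a direction whose orthogonal line through [o]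
    separates them. *)
Lemma star_monotone : D_monotone_spanning_tree (star k).
Proof.
have [KE H1] := KH; split=> [|u v s /star_path_uniq ->]; first exact: star_tree.
suff [i incr] : exists i, strictly_incr (map (proj i) (u :: star_path u v)).
  exact: incr_d_monotone incr.
rewrite /star_path; have [_|uv] := eqVneq u v; first by exists 0%Z.
have [ue|uo] /= := eqVneq u None; first rewrite ue.
  have [vo|vo] := eqVneq v None; first by rewrite ue vo eqxx in uv.
  have [z [_ ->]] := vertP k_gt1 k_even 0 vo.
  by exists z => /=; split=> //; apply: proj_pos; lia.
have [z [_ zu]] := vertP k_gt1 k_even 0 uo.
have [->|vo] /= := eqVneq v None.
  by exists (z - H)%Z; rewrite zu; split=> //; apply: proj_neg; lia.
have [y [yz yv]] := vertP k_gt1 k_even (z - 2 * K + 1) vo.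
have yz' : y <> z by move=> e; move: uv; rewrite zu yv e eqxx.
rewrite zu yv.
(* The direction makes [y] either the last or the first index of the positive half-circle, according
   to which side of [y] leaves [z] on the negative one. *)
have [lo|hi] := Z_le_gt_dec (z - y) K.
  exists (y - H + 1)%Z; split; first by apply: proj_neg; lia.
  by split=> //; apply: proj_pos; lia.
exists (y + H)%Z; split; first by apply: proj_neg; lia.
by split=> //; apply: proj_pos; lia.
Qed.

Lemma star_length :
  tree_length (star k) = \big[Rplus/0%R]_(v : vtx k | v != None) 1%R.
Proof.
rewrite (length_parent star_monotone); apply: eq_bigr => v vo.
have := parent_edge (proj1 star_monotone) vo; rewrite in_star (negbTE vo) addbF.
by move/eqP=> ->; exact: (dist_unit k_gt1 k_even).
Qed.

End Star.

Lemma tree_star k (E : {set vtx k * vtx k}) (treeE : is_tree E) :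
  (forall v, v != None -> parent None treeE v = None) -> E = star k.
Proof.
move=> par_root; apply/setP => -[u v]; rewrite in_star; apply/idP/idP.
  case/(edge_parent None treeE) => -[wo].
    by rewrite par_root // => <-; rewrite (negbTE wo).
  by rewrite par_root // => <-; rewrite (negbTE wo).
have [->|uo] := eqVneq u None; last first.
  by case: eqVneq => // -> _; rewrite (edge_sym treeE) -{1}(par_root _ uo); apply: parent_edge.
by case: eqVneq => // vo _; rewrite -{1}(par_root _ vo); apply: parent_edge.
Qed.

Theorem theorem3 (k : nat) (hk : (2 <= k)%N) (hev : ~~ odd k) :
  D_monotone_spanning_tree (star k) /\
  (forall E : {set vtx k * vtx k}, D_monotone_spanning_tree E -> E <> star k ->
     Rlt (tree_length (star k)) (tree_length E)) /\
  degree (star k) None = k.*2.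
Proof.
split; first exact: star_monotone.
split=> [E monoE E_star|]; last exact: star_degree.
rewrite (star_length hk hev).
case: (pickP (fun w : vtx k => (w != None) && (parent None (proj1 monoE) w != None))).
  by move=> w /andP[wo pw]; exact: (length_gt hk hev wo pw).
move=> par_root; case: E_star; apply: (tree_star (treeE := proj1 monoE)) => v vo.
by apply/eqP; apply: contraFT (par_root v) => pv; rewrite vo pv.
Qed.
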